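(* Let a circle in the Euclidean plane have center $O$, radius $r$ and diameter $AB$. Let $E$ be a point on the diameter produced beyond $A$, and let $D$ be a point of the circle, not on the line $AB$, such that $ED = r$. Suppose that the line $ED$, produced beyond $D$, cuts the circle again at a point $F \neq D$ (so $D$ lies between $E$ and $F$) and meets the tangent to the circle at $B$ in the point $G$. Then the intercepted part of the tangent is greater than the adjacent intercepted arc: $$BG > \overset{\frown}{BF}.$$
   Context: $BG$ denotes the length of the straight segment from $B$ to $G$, and $\overset{\frown}{BF}$ denotes the length of the arc of the circle from $B$ to $F$ that is less than a semicircle. *)

(* Defs.v *)
From Stdlib Require Import Reals List Sorted.
Open Scope R_scope.

Definition point : Type := (R * R)%type.

Definition seg_length (P Q : point) : R := dist_euc (fst P) (snd P) (fst Q) (snd Q).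

Definition affine_pt (P Q : point) (t : R) : point :=
  (fst P + t * (fst Q - fst P), snd P + t * (snd Q - snd P)).

Definition on_line (P Q X : point) : Prop := exists t : R, X = affine_pt P Q t.

Definition strictly_between (P X Q : point) : Prop :=
  exists t : R, 0 < t < 1 /\ X = affine_pt P Q t.

Definition on_circle (O : point) (r : R) (P : point) : Prop := seg_length O P = r.

Definition is_diameter (O : point) (r : R) (A B : point) : Prop :=
  on_circle O r A /\ on_circle O r B /\ strictly_between A O B.

(* The line joining the circle point P to X has no other point on the circle.
   For X = P, on_line degenerates to {P}, so P itself lies on the tangent. *)
Definition on_tangent (O : point) (r : R) (P X : point) : Prop :=
  on_circle O r P /\
  forall Y : point, on_line P X Y -> on_circle O r Y -> Y = P.

Definition circle_pt (O : point) (r t : R) : point :=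
  (fst O + r * cos t, snd O + r * sin t).

(* The parameter interval [a, b] traces the arc with endpoints P and Q that is
   less than a semicircle; that arc may run counterclockwise from P to Q or
   from Q to P. *)
Definition minor_arc (O : point) (r : R) (P Q : point) (a b : R) : Prop :=
  a <= b < a + PI /\
  ((circle_pt O r a = P /\ circle_pt O r b = Q) \/
   (circle_pt O r a = Q /\ circle_pt O r b = P)).

Fixpoint polyline_length (g : R -> point) (a : R) (s : list R) : R :=
  match s with
  | nil => 0
  | t :: s' => seg_length (g a) (g t) + polyline_length g t s'
  end.

(* a :: s is a subdivision of [a, b], so l is the length of a polygonal line
   inscribed in the curve g restricted to [a, b]. *)
Definition inscribed_length (g : R -> point) (a b l : R) : Prop :=
  exists s : list R,
    Sorted Rle (a :: s) /\ last s a = b /\ l = polyline_length g a s.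

(* Arc length is the supremum of the lengths of the inscribed polygonal lines.
   Parametrizations differing by a period give the same inscribed lines, and
   there is no such L when the minor arc does not exist (P and Q antipodal). *)
Definition is_minor_arc_length (O : point) (r : R) (P Q : point) (L : R) : Prop :=
  is_lub (fun l : R => exists a b : R,
            minor_arc O r P Q a b /\ inscribed_length (circle_pt O r) a b l) L.

(* Main.v *)
Require Import Defs.
From Stdlib Require Import Reals List Sorted Lra Psatz.
Open Scope R_scope.

(** Put [O] at the origin, [r = 1], [B = (1, 0)], and let [theta] be the angle at
    [E], with [D] above the axis.  As [ED = OD], the triangle [EDO] is isosceles,
    so [E = (- 2 cos theta, 0)] and [D = (- cos theta, sin theta)]; the exterior
    angle theorem then gives [F = (cos (3 theta), sin (3 theta))].  The arc [BF]
    is thus [3 theta], while [BG = (1 + 2 cos theta) tan theta], and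
    [tan theta + 2 sin theta > 3 theta] because its two sides agree at [0] and
    the derivative of their difference is
    [(1 - cos theta)^2 (1 + 2 cos theta) / cos theta ^ 2]. *)

(** * Trigonometric preliminaries *)

Lemma tan_2sin_gt_3x (x : R) : 0 < x < PI / 2 -> 3 * x < tan x + 2 * sin x.
Proof.
intros [x_gt0 x_lt].
assert (cos_pos : forall y, 0 <= y <= x -> 0 < cos y)
  by (intros y Hy; apply cos_gt_0; lra).
destruct (MVT_cor2 (fun y => tan y + 2 * sin y - 3 * y)
            (fun y => (cos y * cos y - - sin y * sin y) / (cos y)² + 2 * cos y - 3 * 1)
            0 x x_gt0) as [y [Hxy Hy]].
{ intros y Hy.
  apply (derivable_pt_lim_minus (fun y => tan y + 2 * sin y) (fun y => 3 * y)).
  - apply (derivable_pt_lim_plus tan (fun y => 2 * sin y)).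
    + apply (derivable_pt_lim_div sin cos);
        [apply derivable_pt_lim_sin | apply derivable_pt_lim_cos |].
      apply Rgt_not_eq, cos_pos; lra.
    + apply (derivable_pt_lim_scal sin), derivable_pt_lim_sin.
  - apply (derivable_pt_lim_scal id), derivable_pt_lim_id. }
assert (cy_gt0 : 0 < cos y) by (apply cos_pos; lra).
assert (cy_lt1 : cos y < 1).
{ rewrite <- cos_0; apply cos_decreasing_1; lra. }
assert (deriv_eq : (cos y * cos y - - sin y * sin y) / (cos y)² + 2 * cos y - 3 * 1
                   = (1 - cos y) ^ 2 * (1 + 2 * cos y) / cos y ^ 2).
{ generalize (sin2_cos2 y); unfold Rsqr; intro sc.
  replace (cos y * cos y - - sin y * sin y) with 1 by lra.
  field; lra. }
rewrite deriv_eq in Hxy.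
assert (0 < (1 - cos y) ^ 2 * (1 + 2 * cos y) / cos y ^ 2)
  by (apply Rdiv_lt_0_compat; [apply Rmult_lt_0_compat|]; nra).
rewrite tan_0, sin_0 in Hxy.
nra.
Qed.

Lemma unit_vector_angle (x y : R) :
  x * x + y * y = 1 -> exists b, x = cos b /\ y = sin b.
Proof.
intro xy1.
assert (Hx : -1 <= x <= 1) by nra.
assert (Hs : sin (acos x) = Rabs y).
{ rewrite sin_acos by exact Hx.
  rewrite <- sqrt_Rsqr_abs; f_equal; unfold Rsqr; lra. }
(* [acos] reaches only the upper half circle; the lower half takes the opposite angle. *)
destruct (Rle_dec 0 y) as [y_ge0|y_lt0].
- exists (acos x); rewrite cos_acos, Hs, Rabs_right by lra; auto.
- exists (- acos x).
  rewrite cos_neg, sin_neg, cos_acos, Hs, Rabs_left by lra; lra.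
Qed.

(** * Length of a circular arc as a supremum of inscribed lines *)

Lemma chord_length (O : point) (r a b : R) :
  0 <= r ->
  seg_length (circle_pt O r a) (circle_pt O r b)
  = 2 * r * Rabs (sin ((b - a) / 2)).
Proof.
intro r_ge0.
unfold seg_length, dist_euc, circle_pt; simpl.
rewrite <- (Rabs_right (2 * r)), <- Rabs_mult, <- sqrt_Rsqr_abs by lra.
f_equal.
set (h := (b - a) / 2).
replace b with (a + 2 * h) by (unfold h; field).
rewrite cos_plus, sin_plus, cos_2a_sin, sin_2a.
generalize (sin2_cos2 a) (sin2_cos2 h); unfold Rsqr; intros sca sch.
replace (cos a * cos a) with (1 - sin a * sin a) by lra.
set (sa := sin a) in *; set (ca := cos a) in *.
set (sh := sin h) in *; set (ch := cos h) in *.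
(* The two-square identity turns the sum of squares into a product, so [ring] closes this half; both
   trailing factors equal 1. *)
transitivity (4 * r * r * (sh * sh) * ((sa * sa + ca * ca) * (sh * sh + ch * ch))).
- ring.
- rewrite sca, sch; ring.
Qed.

Lemma last_cons (T : Type) (s : list T) (x d : T) : last (x :: s) d = last s x.
Proof.
revert x d; induction s as [|y s IH]; intros x d; [reflexivity|].
exact (eq_trans (IH y d) (eq_sym (IH y x))).
Qed.

Lemma inscribed_length_cons (g : R -> point) (a t b l : R) :
  a <= t -> inscribed_length g t b l ->
  inscribed_length g a b (seg_length (g a) (g t) + l).
Proof.
intros a_le_t [s [s_sorted [s_last ->]]].
exists (t :: s); repeat split.
- constructor; [exact s_sorted | constructor; exact a_le_t].
- now rewrite last_cons.
Qed.

Lemma Rabs_sin_le (x : R) : 0 <= x -> Rabs (sin x) <= x.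
Proof.
intro x_ge0; generalize (SIN_bound x) PI2_1; intros sin_b PI_b.
apply Rabs_le; split.
(* Past [PI] the bound [-1 <= sin x] suffices, since [x > 1] there. *)
- destruct (Rle_dec x PI) as [x_le|x_gt]; [|lra].
  generalize (sin_ge_0 x x_ge0 x_le); lra.
- destruct x_ge0 as [x_gt0|<-].
  + now apply Rlt_le, sin_lt_x.
  + rewrite sin_0; lra.
Qed.

(** Each chord is at most the arc it subtends, and these arcs telescope along the subdivision. *)
Lemma circle_inscribed_length_le (O : point) (r a b l : R) :
  0 <= r -> inscribed_length (circle_pt O r) a b l -> l <= r * (b - a).
Proof.
intros r_ge0 [s [s_sorted [s_last ->]]].
revert a s_sorted s_last.
induction s as [|t s IH]; intros a s_sorted s_last.
- simpl in *; subst; lra.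
- rewrite last_cons in s_last.
  apply Sorted_inv in s_sorted; destruct s_sorted as [s_sorted a_le_t].
  inversion a_le_t; subst.
  specialize (IH t s_sorted eq_refl).
  simpl; rewrite chord_length by exact r_ge0.
  assert (Rabs (sin ((t - a) / 2)) <= (t - a) / 2) by (apply Rabs_sin_le; lra).
  nra.
Qed.

Lemma circle_inscribed_length_regular (O : point) (r h : R) (n : nat) (a : R) :
  0 <= r -> 0 <= h ->
  inscribed_length (circle_pt O r) a (a + INR n * h)
    (INR n * (2 * r * Rabs (sin (h / 2)))).
Proof.
intros r_ge0 h_ge0; revert a; induction n as [|n IH]; intro a.
- exists nil; simpl; repeat split; [now constructor; constructor | ring | ring].
- rewrite S_INR.
  replace (a + (INR n + 1) * h) with (a + h + INR n * h) by ring.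
  replace ((INR n + 1) * (2 * r * Rabs (sin (h / 2))))
    with (seg_length (circle_pt O r a) (circle_pt O r (a + h))
          + INR n * (2 * r * Rabs (sin (h / 2)))).
  + apply inscribed_length_cons; [lra | apply IH].
  + rewrite chord_length by exact r_ge0.
    replace (a + h - a) with h by ring; ring.
Qed.

(** The dot product depends only on the two points and is symmetric in them, so it ignores periods
    and orientation. *)
Lemma circle_pt_angle (O : point) (r a b : R) :
  0 < r -> cos (b - a) = ((fst (circle_pt O r a) - fst O) * (fst (circle_pt O r b) - fst O)
    + (snd (circle_pt O r a) - snd O) * (snd (circle_pt O r b) - snd O)) / (r * r).
Proof.
intro r_gt0; rewrite cos_minus; unfold circle_pt; simpl; field; lra.
Qed.

(** The endpoints determine [cos (d - c)] in either orientation, and [cos] is injective on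
    [[0, PI]]. *)
Lemma minor_arc_angle (O : point) (r a phi c d : R) :
  0 < r -> 0 <= phi < PI ->
  minor_arc O r (circle_pt O r a) (circle_pt O r (a + phi)) c d -> d - c = phi.
Proof.
intros r_gt0 phi_b [cd_b cd_ends].
apply cos_inj; [lra | lra |].
replace phi with ((a + phi) - a) by ring.
rewrite !(circle_pt_angle O r) by exact r_gt0.
destruct cd_ends as [[-> ->]|[-> ->]]; [reflexivity|].
f_equal; ring.
Qed.

(** The upper bound holds because chords are shorter than arcs; no smaller bound [M] survives
    because [sin h / h] tends to 1. *)
Lemma minor_arc_length_circle (O : point) (r a phi : R) :
  0 < r -> 0 < phi < PI ->
  is_minor_arc_length O r (circle_pt O r a) (circle_pt O r (a + phi)) (r * phi).
Proof.
intros r_gt0 phi_b; split.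
- intros l [c [d [cd_arc l_inscr]]].
  rewrite <- (minor_arc_angle O r a phi c d) by (lra || exact cd_arc).
  apply (circle_inscribed_length_le O); [lra | exact l_inscr].
- intros M M_ub.
  destruct (Rle_dec (r * phi) M) as [|M_lt]; [assumption | exfalso].
  assert (rphi_gt0 : 0 < r * phi) by nra.
  (* The regular [n]-gonal line has length [r phi (sin h / h)], [h = phi / 2n]. *)
  destruct (derivable_pt_lim_sin_0 (1 - M / (r * phi))) as [delta Hdelta].
  { apply (Rmult_lt_reg_r (r * phi)); [lra|]; field_simplify; nra. }
  destruct (INR_unbounded (phi / 2 / delta)) as [n Hn].
  assert (delta_gt0 := cond_pos delta).
  assert (n_gt0 : 0 < INR n).
  { apply Rlt_trans with (2 := Hn); repeat apply Rdiv_lt_0_compat; lra. }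
  set (h := phi / INR n / 2).
  assert (h_gt0 : 0 < h) by (unfold h; repeat apply Rdiv_lt_0_compat; lra).
  assert (nh : INR n * h = phi / 2) by (unfold h; field; lra).
  assert (h_lt : h < delta).
  { apply (Rmult_lt_reg_l (INR n)); [lra|]; rewrite nh.
    apply (Rmult_lt_compat_r delta) in Hn; [|lra].
    replace (phi / 2 / delta * delta) with (phi / 2) in Hn by (field; lra); lra. }
  specialize (Hdelta h (Rgt_not_eq _ _ h_gt0)).
  rewrite Rabs_right in Hdelta by lra; specialize (Hdelta h_lt).
  rewrite Rplus_0_l, sin_0, Rminus_0_r in Hdelta.
  (* The tolerance [1 - M / (r * phi)] was chosen so that the lower side reads
     [sin h / h > M / (r * phi)]. *)
  apply Rabs_def2 in Hdelta; destruct Hdelta as [_ Hsin].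
  assert (sin_gt : M < INR n * (2 * r * sin h)).
  { assert (quot : M / (r * phi) < sin h / h) by lra.
    apply (Rmult_lt_compat_r (r * phi)) in quot; [|lra].
    replace (M / (r * phi) * (r * phi)) with M in quot by (field; nra).
    replace (sin h / h * (r * phi)) with (INR n * (2 * r * sin h)) in quot;
      [exact quot|].
    replace phi with (2 * (INR n * h)) by lra; field; lra. }
  assert (l_le : INR n * (2 * r * Rabs (sin h)) <= M).
  { apply M_ub; exists a, (a + phi); split.
    - split; [lra | left; split; reflexivity].
    - replace (a + phi) with (a + INR n * (phi / INR n)) by (field; lra).
      apply circle_inscribed_length_regular; [lra|].
      apply Rlt_le, Rdiv_lt_0_compat; lra. }
  assert (INR n * (2 * r * sin h) <= INR n * (2 * r * Rabs (sin h))).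
  { apply Rmult_le_compat_l; [lra|].
    apply Rmult_le_compat_l; [lra | apply Rle_abs]. }
  lra.
Qed.

Lemma minor_arc_length_sym (O : point) (r : R) (P Q : point) (L : R) :
  is_minor_arc_length O r P Q L -> is_minor_arc_length O r Q P L.
Proof.
assert (arc_sym : forall P Q a b, minor_arc O r P Q a b -> minor_arc O r Q P a b)
  by (unfold minor_arc; tauto).
intros [L_ub L_least]; split.
- intros l [a [b [ab_arc l_inscr]]].
  apply L_ub; exists a, b; auto.
- intros M M_ub; apply L_least.
  intros l [a [b [ab_arc l_inscr]]].
  apply M_ub; exists a, b; auto.
Qed.

(** * Coordinates adapted to the circle *)

(* Coordinates with origin [O] and unit [r], the first axis having direction [b];
   the sign [s] is the orientation of the second axis. *)
Definition frame (O : point) (r b s x y : R) : point :=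
  (fst O + r * (x * cos b - s * (y * sin b)),
   snd O + r * (x * sin b + s * (y * cos b))).

Lemma frame_circle_pt (O : point) (r b s t : R) :
  s = 1 \/ s = -1 -> circle_pt O r (b + s * t) = frame O r b s (cos t) (sin t).
Proof.
unfold circle_pt, frame; intros [->| ->]; rewrite cos_plus, sin_plus.
- rewrite Rmult_1_l; f_equal; ring.
- replace (-1 * t) with (- t) by ring.
  rewrite cos_neg, sin_neg; f_equal; ring.
Qed.

Lemma frame_surj (O : point) (r b s : R) (P : point) :
  0 < r -> s * s = 1 -> exists x y, P = frame O r b s x y.
Proof.
intros r_gt0 ss; generalize (sin2_cos2 b); unfold Rsqr; intro sc.
destruct P as [p q].
set (u := (p - fst O) / r); set (v := (q - snd O) / r).
(* The inverse change of coordinates: rotation by [- b], then the sign [s], which is its own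
   inverse. *)
exists (u * cos b + v * sin b), (s * (v * cos b - u * sin b)).
unfold frame; f_equal.
- replace (_ - _) with (u * (sin b * sin b + cos b * cos b)
    + (1 - s * s) * (v * cos b - u * sin b) * sin b) by ring.
  rewrite sc, ss; unfold u; field; lra.
- replace (_ * sin b + _) with (v * (sin b * sin b + cos b * cos b)
    + (s * s - 1) * (v * cos b - u * sin b) * cos b) by ring.
  rewrite sc, ss; unfold v; field; lra.
Qed.

Lemma frame_dist (O : point) (r b s x y x' y' : R) :
  0 < r -> s * s = 1 ->
  seg_length (frame O r b s x y) (frame O r b s x' y')
  = r * sqrt ((x - x') * (x - x') + (y - y') * (y - y')).
Proof.
intros r_gt0 ss; generalize (sin2_cos2 b); unfold Rsqr; intro sc.
transitivity (sqrt (r * r) * sqrt ((x - x') * (x - x') + (y - y') * (y - y')));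
  [|rewrite sqrt_square by lra; reflexivity].
rewrite <- sqrt_mult_alt by nra.
unfold seg_length, dist_euc, frame; simpl.
f_equal; unfold Rsqr.
transitivity (r * r * ((x - x') * (x - x') + s * s * ((y - y') * (y - y')))
              * (sin b * sin b + cos b * cos b)); [ring|].
rewrite ss, sc; ring.
Qed.

Lemma frame_dist_eq (O : point) (r b s x y x' y' : R) :
  0 < r -> s * s = 1 ->
  seg_length (frame O r b s x y) (frame O r b s x' y') = r <->
  (x - x') * (x - x') + (y - y') * (y - y') = 1.
Proof.
intros r_gt0 ss; rewrite frame_dist by assumption.
set (d := _ + _); assert (d_ge0 : 0 <= d)
  by (apply Rplus_le_le_0_compat; apply Rle_0_sqr).
split; intro H.
- assert (sqrt_d : sqrt d = 1) by (apply (Rmult_eq_reg_l r); lra).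
  rewrite <- (sqrt_sqrt d d_ge0), sqrt_d; ring.
- rewrite H, sqrt_1; ring.
Qed.

Lemma frame_inj (O : point) (r b s x y x' y' : R) :
  0 < r -> s * s = 1 ->
  frame O r b s x y = frame O r b s x' y' -> x = x' /\ y = y'.
Proof.
intros r_gt0 ss H.
assert (H0 : seg_length (frame O r b s x y) (frame O r b s x' y') = 0).
{ rewrite H, frame_dist by assumption.
  rewrite !Rminus_diag, Rmult_0_l, Rplus_0_l, sqrt_0; ring. }
rewrite frame_dist in H0 by assumption.
apply Rmult_integral in H0; destruct H0 as [|Hd]; [lra|].
apply sqrt_eq_0 in Hd;
  [|apply Rplus_le_le_0_compat; apply Rle_0_sqr].
apply Rplus_sqr_eq_0 in Hd; lra.
Qed.

Lemma frame_affine (O : point) (r b s x y x' y' t : R) :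
  affine_pt (frame O r b s x y) (frame O r b s x' y') t
  = frame O r b s (x + t * (x' - x)) (y + t * (y' - y)).
Proof. unfold affine_pt, frame; simpl; f_equal; ring. Qed.

Lemma frame_origin (O : point) (r b s : R) : O = frame O r b s 0 0.
Proof. destruct O; unfold frame; simpl; f_equal; ring. Qed.

Lemma frame_on_circle (O : point) (r b s x y : R) :
  0 < r -> s * s = 1 ->
  on_circle O r (frame O r b s x y) <-> x * x + y * y = 1.
Proof.
intros r_gt0 ss; unfold on_circle.
rewrite (frame_origin O r b s) at 1.
rewrite frame_dist_eq by assumption.
replace ((0 - x) * (0 - x) + (0 - y) * (0 - y)) with (x * x + y * y) by ring.
reflexivity.
Qed.

Lemma on_circle_angle (O : point) (r : R) (P : point) :
  0 < r -> on_circle O r P -> exists b, P = circle_pt O r b.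
Proof.
intros r_gt0 hP.
destruct (frame_surj O r 0 1 P) as [x [y ->]]; [lra | lra |].
apply frame_on_circle in hP; [|lra|lra].
apply unit_vector_angle in hP; destruct hP as [b [-> ->]].
exists (0 + 1 * b); rewrite <- frame_circle_pt by auto; reflexivity.
Qed.

(** Betweenness solved for an end of the segment rather than its inner point, with
    [k = 1 / (1 - t)]. The points [A], [E], [F] and [G] are all located this way. *)
Lemma frame_strictly_between (O : point) (r b s x y x' y' : R) (P : point) :
  0 < r -> s * s = 1 ->
  strictly_between P (frame O r b s x y) (frame O r b s x' y') ->
  exists k, 1 < k /\ P = frame O r b s (x' + k * (x - x')) (y' + k * (y - y')).
Proof.
intros r_gt0 ss [t [t_b Ht]].
destruct (frame_surj O r b s P r_gt0 ss) as [p [q ->]].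
rewrite frame_affine in Ht; apply frame_inj in Ht; [|assumption|assumption].
destruct Ht as [-> ->].
exists (/ (1 - t)); split.
- rewrite <- Rinv_1; apply Rinv_lt_contravar; lra.
- f_equal; field; lra.
Qed.

Lemma strictly_between_sym (P X Q : point) :
  strictly_between P X Q -> strictly_between Q X P.
Proof.
intros [t [t_b ->]]; exists (1 - t); split; [lra|].
unfold affine_pt; f_equal; ring.
Qed.

Lemma frame_diameter (O : point) (r b s : R) (A : point) :
  0 < r -> s * s = 1 -> is_diameter O r A (frame O r b s 1 0) ->
  A = frame O r b s (-1) 0.
Proof.
intros r_gt0 ss [hA [_ hO]].
rewrite (frame_origin O r b s) in hO at 1.
apply frame_strictly_between in hO; [|assumption|assumption].
destruct hO as [k [k_gt1 ->]].
apply frame_on_circle in hA; [|assumption|assumption].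
assert (k = 2) by nra.
f_equal; lra.
Qed.

(** If [x <> 1], the line is not perpendicular to the radius at the point of contact, so it meets
    the circle a second time. *)
Lemma frame_tangent (O : point) (r b s x y : R) :
  0 < r -> s * s = 1 ->
  on_tangent O r (frame O r b s 1 0) (frame O r b s x y) -> x = 1.
Proof.
intros r_gt0 ss [_ htan].
destruct (Req_dec x 1) as [|x_neq]; [assumption | exfalso].
assert (d_gt0 : 0 < (x - 1) * (x - 1) + y * y) by nra.
(* The second intersection of the line with the circle. *)
set (t := - 2 * (x - 1) / ((x - 1) * (x - 1) + y * y)).
assert (ht : t * ((x - 1) * (x - 1) + y * y) = - 2 * (x - 1))
  by (unfold t; field; lra).
specialize (htan (affine_pt (frame O r b s 1 0) (frame O r b s x y) t)).
rewrite frame_affine, frame_on_circle in htan by assumption.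
assert (H : frame O r b s (1 + t * (x - 1)) (0 + t * (y - 0)) = frame O r b s 1 0).
{ apply htan.
  - exists t; now rewrite frame_affine.
  - transitivity (1 + t * (2 * (x - 1) + t * ((x - 1) * (x - 1) + y * y))); [ring|].
    rewrite ht; ring. }
apply frame_inj in H; [|assumption|assumption].
destruct H as [H _].
assert (t = 0) by nra.
nra.
Qed.

(** Reflecting the second axis when necessary justifies taking [D] above the diameter. *)
Lemma frame_oriented (O : point) (r b : R) (P : point) :
  0 < r -> ~ (exists x, P = frame O r b 1 x 0) ->
  exists s x y, (s = 1 \/ s = -1) /\ 0 < y /\ P = frame O r b s x y.
Proof.
intros r_gt0 hP.
destruct (frame_surj O r b 1 P) as [x [y ->]]; [lra | lra |].
destruct (Rtotal_order y 0) as [y_lt0|[->|y_gt0]].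
- exists (-1), x, (- y); repeat split; [now right | lra |].
  unfold frame; f_equal; ring.
- exfalso; apply hP; now exists x.
- exists 1, x, y; auto.
Qed.

(** * The configuration in coordinates *)

Theorem theorem2p11 (O : point) (r : R) (A B E D F G : point)
  (hr : 0 < r)
  (hAB : is_diameter O r A B)
  (hE : strictly_between E A B)
  (hD : on_circle O r D)
  (hDAB : ~ on_line A B D)
  (hED : seg_length E D = r)
  (hF : on_circle O r F)
  (hFD : F <> D)
  (hEDF : strictly_between E D F)
  (hG : on_tangent O r B G)
  (hEDG : strictly_between E D G) :
  exists BF : R, is_minor_arc_length O r B F BF /\ seg_length B G > BF.
Proof.
destruct (on_circle_angle O r B hr (proj1 (proj2 hAB))) as [b B_circle].
assert (B_frame : forall s, s = 1 \/ s = -1 -> B = frame O r b s 1 0).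
{ intros s hs; generalize (frame_circle_pt O r b s 0 hs).
  rewrite cos_0, sin_0; intros <-; rewrite B_circle; f_equal; ring. }
destruct (frame_oriented O r b D hr) as [s [x [w [hs [w_gt0 D_frame]]]]].
(* The parameter [(x + 1) / 2] sends [A], at abscissa -1, to 0 and [B], at abscissa 1, to 1. *)
{ intros [x ->]; apply hDAB; exists ((x + 1) / 2).
  rewrite (B_frame 1) in hAB |- * by auto.
  rewrite (frame_diameter O r b 1 A) by (lra || exact hAB).
  rewrite frame_affine; f_equal; field. }
assert (ss : s * s = 1) by (destruct hs; subst; ring).
specialize (B_frame s hs).
rewrite B_frame in hAB.
apply frame_diameter in hAB; [|assumption|assumption].
subst A D; rewrite B_frame in hE, hG.
apply frame_strictly_between in hE; [|assumption|assumption].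
destruct hE as [e [e_gt1 ->]].
apply frame_on_circle in hD; [|assumption|assumption].
apply frame_dist_eq in hED; [|assumption|assumption].
set (c := - x); replace x with (- c) in * by (unfold c; ring); clearbody c.
(* Subtracting the equations for [ED] and [OD] leaves the abscissas 0 and [- (2 * c)] for [E];
   [e > 1] rules out 0. *)
assert (E_x : 1 + e * (-1 - 1) = - (2 * c)) by nra.
rewrite E_x in *.
replace (0 + e * (0 - 0)) with 0 in * by ring.
assert (c_gt : 1 / 2 < c) by lra.
assert (c_le : c < 1) by nra.
apply strictly_between_sym, frame_strictly_between in hEDF; [|assumption|assumption].
destruct hEDF as [k [k_gt1 ->]].
apply strictly_between_sym, frame_strictly_between in hEDG; [|assumption|assumption].
destruct hEDG as [m [_ ->]].
apply frame_tangent in hG; [|assumption|assumption].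
apply frame_on_circle in hF; [|assumption|assumption].
(* Intersecting line [ED] with the circle gives a quadratic in [k]: one root, 1, is [D], and the
   product of the roots is the power of [E], [4 * (c * c) - 1]. *)
assert (k_eq : k = 4 * (c * c) - 1).
{ assert (H : (k - 1) * (k - (4 * (c * c) - 1)) = 0).
  { assert (k * k * (w * w) = k * k * (1 - c * c)) by (f_equal; lra).
    nra. }
  apply Rmult_integral in H; lra. }
set (theta := acos c).
assert (cos_theta : cos theta = c) by (apply cos_acos; lra).
assert (theta_b : 0 <= theta <= PI) by apply acos_bound.
assert (sin_theta : sin theta = w).
{ assert (sin_ge0 : 0 <= sin theta) by (apply sin_ge_0; lra).
  generalize (sin2_cos2 theta); unfold Rsqr; rewrite cos_theta; nra. }
assert (theta_gt0 : 0 < theta).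
{ destruct (proj1 theta_b) as [|theta0]; [assumption|].
  rewrite <- theta0, cos_0 in cos_theta; lra. }
(* [E] lies beyond [A], whence [c > 1 / 2]; this keeps the arc [3 * theta] below a semicircle. *)
assert (theta_lt : theta < PI / 3).
{ apply cos_decreasing_0; try lra.
  rewrite cos_PI3, cos_theta; exact c_gt. }
assert (F_circle : frame O r b s (- (2 * c) + k * (- c - - (2 * c))) (0 + k * (w - 0))
                   = circle_pt O r (b + s * (3 * theta))).
{ rewrite frame_circle_pt by exact hs.
  replace (3 * theta) with (theta + 2 * theta) by ring.
  rewrite cos_plus, sin_plus, cos_2a_cos, sin_2a, cos_theta, sin_theta, k_eq.
  f_equal; [|ring].
  replace (c * (2 * c * c - 1) - w * (2 * w * c))
    with (c * (2 * c * c - 1) - 2 * c * (w * w)) by ring.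
  replace (w * w) with (1 - c * c) by lra; ring. }
exists (r * (3 * theta)); split.
- rewrite F_circle, B_circle.
  destruct hs as [->| ->].
  + rewrite Rmult_1_l; apply minor_arc_length_circle; lra.
  (* With reversed orientation the counterclockwise arc starts at [F] and ends at [B]. *)
  + apply minor_arc_length_sym.
    replace b with (b + -1 * (3 * theta) + 3 * theta) at 2 by ring.
    apply minor_arc_length_circle; lra.
- rewrite hG, B_frame, frame_dist by assumption.
  apply Rmult_lt_compat_l; [exact hr|].
  assert (G_y : 0 + m * (w - 0) = tan theta + 2 * sin theta).
  { unfold tan; rewrite cos_theta, sin_theta.
    (* [m] is read off from the abscissa of [G], which is 1 on the tangent. *)
    replace m with ((1 + 2 * c) / c); [field; lra|].
    apply (Rmult_eq_reg_r c); [field_simplify; lra | lra]. }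
  rewrite G_y.
  assert (tan_sin := tan_2sin_gt_3x theta).
  replace (_ + _) with ((tan theta + 2 * sin theta) * (tan theta + 2 * sin theta)) by ring.
  rewrite sqrt_square; lra.
Qed.
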